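(* Let $a,c,p_m,e_m,e_0,f,\varepsilon,\mu,\beta_H,\beta_L$ be real parameters with $f,e_m,e_0>0$, $0<\varepsilon<1$, $0<\mu<1$, $\beta_H>\beta_L>0$, and let $w_H^{(3)},w_L^{(3)},w_H^{(4)},w_L^{(4)}$ be the buy-back prices defined in the context. Assume $$\beta_H\left(4\beta_L-c^2-\beta_L^2+\mu\beta_L\right)<\beta_L\left(\mu c^2-\mu\beta_H^2\right).$$ (i) If $e_m<\dfrac{e_0}{\beta_L}$, then $w_H^{(4)}>w_H^{(3)}$ and $w_L^{(4)}>w_L^{(3)}$. (ii) If $e_m>\dfrac{e_0}{\beta_L}$, then $w_H^{(4)}<w_H^{(3)}$ and $w_L^{(4)}<w_L^{(3)}$.
   Context: A manufacturer buys back waste products from retailer one, who has a private type: high ($H$, recycling difficulty coefficient $\beta_H$) or low ($L$, coefficient $\beta_L$, having probability $\mu$). Parameters: $a$ potential market demand, $\varepsilon$ substitute coefficient, $c$ a unit cost of retailer one, $p_m$ the manufacturer's price to retailers, $f$ the unit degree of reward/penalty, $e_m$ the manufacturer's unit carbon emission, $e_0$ the carbon emission upper limit. Model III is decentralized with competing retailers; Model IV is the same with the carbon emission constraint. The buy-back prices of the two models for the two types are the following expressions. Put $$\Delta=2\beta_H\left(4\beta_L-c^2-\beta_L^2+\beta_L\mu\right)-2\beta_L\mu\left(c^2-\beta_H^2\right).$$ Model III: $$w_H^{(3)}=\frac{\beta_L\left(2a+2c-2p_m+a\varepsilon-c\varepsilon p_m-c\varepsilon^2p_m+\varepsilon^2p_m-ac\varepsilon-2ac\right)}{\Delta},$$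 $$w_L^{(3)}=\frac{\beta_H\left(2a\beta_L-c\varepsilon p_m+\varepsilon\beta_Lp_m-c\varepsilon^2p_m+\varepsilon^2\beta_Lp_m-ac\varepsilon+a\varepsilon\beta_L-2ac\right)+2\beta_L(cp_m-\beta_Lp_m)}{\Delta}.$$ Model IV: $$w_H^{(4)}=\frac{\beta_L\left(2a+2c-2p_m+a\varepsilon-c\varepsilon p_m-c\varepsilon^2p_m+\varepsilon^2p_m-ac\varepsilon-2ac+fe_m\right)-fe_0}{\Delta},$$ $$w_L^{(4)}=\frac{\beta_H\left(2a\beta_L-c\varepsilon p_m+\varepsilon\beta_Lp_m-c\varepsilon^2p_m+\varepsilon^2\beta_Lp_m-ac\varepsilon+a\varepsilon\beta_L-2ac\right)+\beta_L\left(2cp_m-2\beta_Lp_m+fe_m\right)-fe_0}{\Delta}.$$ *)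

(* Defs.v *)
From Stdlib Require Import Reals.
Open Scope R_scope.

Definition price_Delta (c mu betaH betaL : R) : R :=
  2 * betaH * (4 * betaL - c ^ 2 - betaL ^ 2 + betaL * mu)
  - 2 * betaL * mu * (c ^ 2 - betaH ^ 2).

(* The parameters are: market demand a, unit cost c of retailer one, price pm
   charged by the manufacturer, substitute coefficient eps, probability mu of
   the low type, recycling difficulty coefficients betaH and betaL, unit
   reward/penalty f, unit emission em, emission limit e0. The suffixes 3 and 4
   are the model numbers: decentralized with competing retailers, without and
   with the carbon emission constraint. *)

Definition wH3 (a c pm eps mu betaH betaL : R) : R :=
  betaL * (2 * a + 2 * c - 2 * pm + a * eps - c * eps * pm
           - c * eps ^ 2 * pm + eps ^ 2 * pm - a * c * eps - 2 * a * c)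
  / price_Delta c mu betaH betaL.

Definition wL3 (a c pm eps mu betaH betaL : R) : R :=
  (betaH * (2 * a * betaL - c * eps * pm + eps * betaL * pm
            - c * eps ^ 2 * pm + eps ^ 2 * betaL * pm
            - a * c * eps + a * eps * betaL - 2 * a * c)
   + 2 * betaL * (c * pm - betaL * pm))
  / price_Delta c mu betaH betaL.

Definition wH4 (a c pm eps mu betaH betaL f em e0 : R) : R :=
  (betaL * (2 * a + 2 * c - 2 * pm + a * eps - c * eps * pm
            - c * eps ^ 2 * pm + eps ^ 2 * pm - a * c * eps - 2 * a * c
            + f * em)
   - f * e0)
  / price_Delta c mu betaH betaL.

Definition wL4 (a c pm eps mu betaH betaL f em e0 : R) : R :=
  (betaH * (2 * a * betaL - c * eps * pm + eps * betaL * pm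
            - c * eps ^ 2 * pm + eps ^ 2 * betaL * pm
            - a * c * eps + a * eps * betaL - 2 * a * c)
   + betaL * (2 * c * pm - 2 * betaL * pm + f * em)
   - f * e0)
  / price_Delta c mu betaH betaL.

(* Main.v *)
Require Import Defs.
From Stdlib Require Import Reals Lra.
Open Scope R_scope.

(** Under the carbon constraint each numerator gains the same amount, the total
    net reward [f * (betaL * em - e0)], so both prices are shifted by this amount
    over the common denominator [price_Delta] ([wH4_shift], [wL4_shift]). The
    assumption on the coefficients says precisely that this denominator is
    negative, so the shift has the sign opposite to that of [betaL * em - e0]:
    prices rise when [em] is below the threshold [e0 / betaL] and fall when it
    is above. *)

Lemma wH4_shift (a c pm eps mu betaH betaL f em e0 : R) :
  wH4 a c pm eps mu betaH betaL f em e0 =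
  wH3 a c pm eps mu betaH betaL
  + f * (betaL * em - e0) / price_Delta c mu betaH betaL.
Proof. unfold wH4, wH3, Rdiv; ring. Qed.

Lemma wL4_shift (a c pm eps mu betaH betaL f em e0 : R) :
  wL4 a c pm eps mu betaH betaL f em e0 =
  wL3 a c pm eps mu betaH betaL
  + f * (betaL * em - e0) / price_Delta c mu betaH betaL.
Proof. unfold wL4, wL3, Rdiv; ring. Qed.

Theorem proposition3
  (a c pm em e0 f eps mu betaH betaL : R)
  (hf : 0 < f) (hem : 0 < em) (he0 : 0 < e0)
  (heps : 0 < eps < 1) (hmu : 0 < mu < 1)
  (hbetaL : 0 < betaL) (hbetaHL : betaL < betaH)
  (hcond : betaH * (4 * betaL - c ^ 2 - betaL ^ 2 + mu * betaL)
           < betaL * (mu * c ^ 2 - mu * betaH ^ 2)) :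
  (em < e0 / betaL ->
     wH4 a c pm eps mu betaH betaL f em e0 > wH3 a c pm eps mu betaH betaL /\
     wL4 a c pm eps mu betaH betaL f em e0 > wL3 a c pm eps mu betaH betaL)
  /\
  (em > e0 / betaL ->
     wH4 a c pm eps mu betaH betaL f em e0 < wH3 a c pm eps mu betaH betaL /\
     wL4 a c pm eps mu betaH betaL f em e0 < wL3 a c pm eps mu betaH betaL).
Proof.
  assert (hDelta : price_Delta c mu betaH betaL < 0)
    by (unfold price_Delta; lra).
  rewrite wH4_shift, wL4_shift.
  assert (he0L : e0 = betaL * (e0 / betaL)) by (field; lra).
  split; intros hthr; apply (Rmult_lt_compat_l betaL) in hthr; try assumption;
    rewrite <- he0L in hthr.
  - assert (hnum : f * (betaL * em - e0) < 0) by (apply Rmult_pos_neg; lra).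
    pose proof (Rdiv_neg_neg _ _ hnum hDelta); lra.
  - assert (hnum : 0 < f * (betaL * em - e0)) by (apply Rmult_lt_0_compat; lra).
    pose proof (Rdiv_pos_neg _ _ hnum hDelta); lra.
Qed.
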